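(* Let $X$ be a real Banach space. Let $F:[0,1]\to\mathrm{b}(X)$ be a multifunction such that its convex hull $\operatorname{conv}F$ is Riemann integrable and $A=\int_0^1\operatorname{conv}F(t)\,dt$ is compact. Then the multifunction $F$ is also Riemann integrable, and $\int_0^1F(t)\,dt=A$.
   Context: Let $\mathrm{b}(X)$ be the collection of all non-empty bounded subsets of $X$ and $\mathrm{clb}(X)$ the subcollection of closed ones. A multifunction $F:[0,1]\to\mathrm{b}(X)$ is a map assigning to each $t\in[0,1]$ a non-empty bounded set $F(t)\subset X$. $\operatorname{conv}F$ is the multifunction $t\mapsto\operatorname{conv}(F(t))$ (ordinary convex hull, no closure taken). For $A,B\subset X$ and a scalar $\lambda$: $A+B=\{a+b: a\in A, b\in B\}$ (Minkowski sum), $\lambda A=\{\lambda a: a\in A\}$. The Hausdorff distance (a pseudometric on $\mathrm{b}(X)$) is $\rho_H(A,B)=\max\{\sup_{b\in B}\rho(b,A),\ \sup_{a\in A}\rho(a,B)\}$, where $\rho(x,A)=\inf_{a\in A}\|x-a\|$. A tagged partition $T=\{\Delta_i,t_i\}_{i=1}^n$ of $[0,1]$ consists of a partition of $[0,1]$ into consecutive intervals $\Delta_i=[x_{i-1},x_i]$, $0=x_0<\dots<x_n=1$, and points $t_i\in\Delta_i$; $d(T)=\max_i|\Delta_i|$, where $|\Delta_i|$ is the length. The Riemann sum is $S(F,T)=\sum_{i=1}^n|\Delta_i|F(t_i)$. $F$ is Riemann integrable if there is a set $A\in\mathrm{clb}(X)$ (then unique, called the Riemann integral $\int_0^1F(t)\,dt$)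 such that for every $\varepsilon>0$ there is $\delta>0$ with $\rho_H(S(F,T),A)<\varepsilon$ for every tagged partition $T$ with $d(T)<\delta$. *)

(* Defs.v *)
From HB Require Import structures.
From mathcomp Require Import all_boot all_order all_algebra.
From mathcomp Require Import all_classical all_reals all_analysis.
Import Order.TTheory GRing.Theory Num.Theory.
Import numFieldNormedType.Exports.

Set Implicit Arguments.
Unset Strict Implicit.
Unset Printing Implicit Defensive.

Local Open Scope classical_set_scope.
Local Open Scope ring_scope.

Section sets.
Context {R : realType} {X : normedModType R}.
Implicit Types (A B : set X) (x : X).

Definition in_b A := A !=set0 /\ bounded_set A.

Definition in_clb A := in_b A /\ closed A.

Definition minkowski_sum A B : set X := [set a + b | a in A & b in B].

Definition dilation (c : R) A : set X := [set c *: a | a in A].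

Definition convex_hull A : set X := smallest (@convex_set R X) A.

(* The distances take values in the extended reals, so that the suprema and
   infima carry no default values; on nonempty bounded sets they are finite. *)
Definition dist_set x A : \bar R := ereal_inf [set `|x - a|%:E | a in A].

Definition hausdorff_dist A B : \bar R :=
  Order.max (ereal_sup [set dist_set b A | b in B])
            (ereal_sup [set dist_set a B | a in A]).

End sets.

(* [tp_points] lists x_1 < ... < x_n = 1; the left endpoint x_0 = 0 is kept
   implicit, as in [itv_partition]. *)
Record tagged_partition (R : realType) := TaggedPartition {
  tp_points : seq R ;
  tp_tag : 'I_(size tp_points) -> R ;
  tp_partition : itv_partition 0 1 tp_points ;
  tp_tagP : forall i : 'I_(size tp_points),
    nth 1 (0 :: tp_points) i <= tp_tag i <= nth 1 (0 :: tp_points) i.+1 }.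

Section riemann.
Context {R : realType} {X : normedModType R}.
Implicit Types (F : R -> set X) (A : set X) (T : tagged_partition R).

Definition tp_length T (i : nat) : R :=
  nth 1 (0 :: tp_points T) i.+1 - nth 1 (0 :: tp_points T) i.

Definition mesh T : R :=
  \big[Order.max/0]_(i < size (tp_points T)) tp_length T i.

Definition riemann_sum F T : set X :=
  \big[minkowski_sum/[set 0]]_(i < size (tp_points T))
    dilation (tp_length T i) (F (tp_tag i)).

Definition is_riemann_integral F A :=
  in_clb A /\
  forall eps : R, 0 < eps -> exists2 delta : R, 0 < delta &
    forall T, mesh T < delta ->
      (hausdorff_dist (riemann_sum F T) A < eps%:E)%E.

Definition riemann_integrable F := exists A, is_riemann_integral F A.

(* Only meaningful when [riemann_integrable F] (and [set0] otherwise);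
   see [riemann_integralP]. *)
Definition riemann_integral F : set X := xget set0 (is_riemann_integral F).

End riemann.

Section uniqueness.
Context {R : realType} {X : normedModType R}.
Implicit Types (F : R -> set X) (A B : set X) (T : tagged_partition R).

Lemma dist_set_lt (x : X) A (e : R) :
  (dist_set x A < e%:E)%E -> exists2 a, A a & `|x - a| < e.
Proof.
move=> /ereal_inf_lt[_ [a Aa <-]]; rewrite lte_fin => h.
by exists a.
Qed.

Lemma hausdorff_dist_lt A B (e : R) : (hausdorff_dist A B < e%:E)%E ->
  (forall b, B b -> exists2 a, A a & `|b - a| < e) /\
  (forall a, A a -> exists2 b, B b & `|a - b| < e).
Proof.
rewrite /hausdorff_dist gt_max => /andP[h1 h2]; split=> x xP.
- by apply/dist_set_lt/(le_lt_trans _ h1)/ereal_sup_ubound; exists x.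
- by apply/dist_set_lt/(le_lt_trans _ h2)/ereal_sup_ubound; exists x.
Qed.

Lemma exists_fine_tagged_partition (delta : R) : 0 < delta ->
  exists T, mesh T < delta.
Proof.
move=> d0; pose n := Num.truncn delta^-1.
have dn : (n.+1%:R)^-1 < delta.
  by rewrite -[ltRHS]invrK ltf_pV2 ?posrE ?invr_gt0// truncnS_gt.
pose s : seq R := mkseq (fun i => i.+1%:R / n.+1%:R) n.+1.
have ss : size s = n.+1 by rewrite size_mkseq.
have nthE i : (i <= n.+1)%N -> nth 1 (0 :: s) i = i%:R / n.+1%:R.
  by case: i => [|i] hi; rewrite /= ?mul0r// nth_mkseq.
have sp : itv_partition 0 1 s.
  split.
    apply/(pathP 1) => i; rewrite ss => hi.
    rewrite nthE 1?ltnW// -[nth 1 s i]/(nth 1 (0 :: s) i.+1) nthE//.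
    by rewrite ltr_pM2r ?invr_gt0// ltr_nat.
  rewrite (last_nth 1) ss nthE// divff//.
have tP (i : 'I_(size s)) :
    nth 1 (0 :: s) i <= nth 1 (0 :: s) i <= nth 1 (0 :: s) i.+1.
  have hi : (i < n.+1)%N by rewrite -[ltnRHS]ss.
  by rewrite lexx nthE 1?ltnW// nthE// ler_pM2r ?invr_gt0// ler_nat leqnSn.
exists (TaggedPartition sp tP).
apply/bigmax_ltP; split=> //= i _; rewrite /tp_length.
have hi : (i < n.+1)%N by rewrite -[ltnRHS]ss.
by rewrite nthE// nthE 1?ltnW// -mulrBl -natrB// subSnn mul1r.
Qed.

Lemma riemann_integral_sub F A B :
  is_riemann_integral F A -> is_riemann_integral F B -> A `<=` B.
Proof.
move=> [_ hA] [[_ cB] hB] a Aa; apply: cB => U /nbhs_ballP[e /= e0 aeU].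
have e20 : 0 < e / 2 by rewrite divr_gt0.
have [d1 d10 h1] := hA _ e20; have [d2 d20 h2] := hB _ e20.
have [T] : exists T, mesh T < Order.min d1 d2.
  by apply: exists_fine_tagged_partition; rewrite lt_min d10.
rewrite lt_min => /andP[/h1/hausdorff_dist_lt[hS _] /h2/hausdorff_dist_lt[_ hb]].
have [x /hb[b Bb xb] ax] := hS _ Aa.
exists b; split=> //; apply: aeU; rewrite -ball_normE /=.
by rewrite (splitr e); apply: (le_lt_trans (ler_distD x _ _)); exact: ltrD.
Qed.

Lemma riemann_integral_unique F A B :
  is_riemann_integral F A -> is_riemann_integral F B -> A = B.
Proof.
move=> hA hB; rewrite eqEsubset; split;
  [exact: (riemann_integral_sub hA hB) | exact: (riemann_integral_sub hB hA)].
Qed.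

Lemma riemann_integralP F A :
  is_riemann_integral F A <-> riemann_integrable F /\ riemann_integral F = A.
Proof.
split=> [hA|[[B hB] <-]]; last exact: (xgetI set0 hB).
split; first by exists A.
exact: riemann_integral_unique (xgetI set0 hA) hA.
Qed.

End uniqueness.

(* Main.v *)
From HB Require Import structures.
Require Import Defs.
From mathcomp Require Import all_boot all_order all_algebra finmap.
From mathcomp Require Import all_classical all_reals all_analysis.
From mathcomp Require Import ring lra.
Import Order.TTheory GRing.Theory Num.Theory.
Import numFieldNormedType.Exports.
Local Open Scope classical_set_scope.
Local Open Scope ring_scope.

(** Write S(F, T) for a Riemann sum of F. Since S(F, T) is contained in
    S(conv F, T), every point of S(F, T) is close to the integral A of conv F
    as soon as T is fine. The content of the theorem is the converse: each a in
    A has to be approximated by points of S(F, T). Integrability provides a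
    point sum_k l_k y_k of S(conv F, T) close to a, with l_k the lengths of the
    intervals and y_k in conv F(t_k), and the y_k must be traded for points z_k
    of F(t_k) without moving the sum much.

    The trade is made greedily ([balanced_selection]). Fix finitely many linear
    functionals phi_i of norm at most 1 and put Q(x) = sum_i phi_i(x)^2. Let e
    be the sum of the errors l_j (z_j - y_j) over the indices already treated,
    and let k be another index. The half-space
    of the v at which the differential of Q at e exceeds its value at y_k is
    convex and misses y_k, so it cannot contain F(t_k): some z_k in F(t_k) makes
    the first-order variation of Q nonpositive, and Q grows by the second-order
    term alone, at most a multiple of l_k^2. As sum_k l_k^2 is at most the mesh,
    the final error has a small Q. This uses that F is bounded on [0, 1], which
    follows from the integrability of conv F by moving a single tag of one
    fixed fine partition ([riemann_integrable_bounded]).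

    Smallness of Q at the error says that finitely many functionals are small
    there, and compactness of A turns this into smallness of a norm. The sums
    s = sum_k l_k z_k and x = sum_k l_k y_k are both close to A, say to b and a,
    and finitely many functionals suffice to compute, up to a given
    precision, the norm of all differences of points of A: take functionals
    norming the differences of the points of a finite net
    ([compact_finite_norming]). Hence a - b is small, and so is a - s.

    The norming functionals come from the Hahn-Banach theorem, in the form: a
    sublinear function dominates a linear one. Minimal sublinear functions exist
    by Zorn's lemma and are linear. *)

(** * Sublinear functions and norming functionals *)

Section sublinear.
Context {R : realType} {V : lmodType R}.
Implicit Types (p q : V -> R) (P : set (V -> R)) (x y a : V).

Definition sublinear p :=
  (forall x y, p (x + y) <= p x + p y) /\
  (forall (t : R) x, 0 <= t -> p (t *: x) <= t * p x).

Lemma sublinear0 p : sublinear p -> p 0 = 0.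
Proof.
move=> [pD pZ]; have := pD 0 0; have := pZ 0 0 (lexx 0).
rewrite scale0r addr0 mul0r; lra.
Qed.

Lemma sublinearN p x : sublinear p -> - p (- x) <= p x.
Proof.
by move=> sp; have := sp.1 x (- x); rewrite subrr (sublinear0 _ sp); lra.
Qed.

Lemma sublinear_ge p (t : R) x : sublinear p -> 0 <= t -> t * p x <= p (t *: x).
Proof.
move=> sp; rewrite le_eqVlt => /predU1P[<-|t0].
  by rewrite mul0r scale0r sublinear0.
rewrite -ler_pdivlMl//; apply: le_trans (sp.2 _ _ _); last first.
  by rewrite invr_ge0 ltW.
by rewrite scalerA mulVf ?scale1r// gt_eqF.
Qed.

Definition pointwise_inf P x := inf [set p x | p in P].

Lemma pointwise_inf_lb P (lb : V -> R) p x :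
  (forall p x, P p -> lb x <= p x) -> P p -> pointwise_inf P x <= p x.
Proof.
move=> hlb Pp; apply: ge_inf; last by exists p.
by exists (lb x) => _ [q Pq <-]; exact: hlb.
Qed.

Lemma pointwise_inf_ge P x (c : R) : P !=set0 ->
  (forall p, P p -> c <= p x) -> c <= pointwise_inf P x.
Proof.
move=> [p Pp] h; apply: lb_le_inf; first by exists (p x), p.
by move=> _ [q Pq <-]; exact: h.
Qed.

(** The members of the family need not be sublinear: it is enough that the
    family as a whole satisfies the two inequalities, the left-hand sides being
    allowed to use another member. This covers both chains of sublinear
    functions and the family [slope_family] below. *)
Lemma pointwise_inf_sublinear P (lb : V -> R) : P !=set0 ->
  (forall p x, P p -> lb x <= p x) ->
  (forall p q, P p -> P q ->
    exists2 k, P k & forall x y, k (x + y) <= p x + q y) ->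
  (forall p (t : R), P p -> 0 <= t ->
    exists2 k, P k & forall x, k (t *: x) <= t * p x) ->
  sublinear (pointwise_inf P).
Proof.
move=> P0 hlb hD hZ; split=> [x y|t x].
  rewrite -lerBlDr; apply: pointwise_inf_ge => // p Pp.
  rewrite lerBlDr -lerBlDl; apply: pointwise_inf_ge => // q Pq.
  have [k Pk hk] := hD _ _ Pp Pq; have := hk x y.
  by have := pointwise_inf_lb _ _ _ (x + y) hlb Pk; lra.
have hle p : P p -> 0 <= t -> pointwise_inf P (t *: x) <= t * p x.
  move=> Pp t0; have [k Pk hk] := hZ _ _ Pp t0.
  exact: le_trans (pointwise_inf_lb _ _ _ _ hlb Pk) (hk x).
rewrite le_eqVlt => /predU1P[t0|t0].
  have [p Pp] := P0; apply: le_trans (hle _ Pp _) _; first by rewrite -t0.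
  by rewrite -t0 !mul0r.
rewrite -ler_pdivrMl//; apply: pointwise_inf_ge => // p Pp.
by rewrite ler_pdivrMl// hle// ltW.
Qed.

(** The infimum of this family is the largest sublinear function below [p] whose
    value at [- a] is at most [- p a]; if [p] is minimal, it has to be [p],
    which makes [p] additive in the direction [a]. *)
Definition slope_family p a : set (V -> R) :=
  [set (fun x => p (x + t *: a) - t * p a) | t in [set t : R | 0 <= t]].

Lemma slope_family_lb p a q x : sublinear p ->
  slope_family p a q -> - p (- x) <= q x.
Proof.
move=> sp [t t0 <-]; have := sublinear_ge p t a sp t0.
by have := sp.1 (- x) (x + t *: a); rewrite addKr; lra.
Qed.

(** The value of the term of parameter [t + s] at [x + y] is at most the sum of
    the terms of parameters [t] at [x] and [s] at [y]; scaling by [t] matches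
    parameter [s] with parameter [t * s]. *)
Lemma slope_sublinear p a : sublinear p ->
  sublinear (pointwise_inf (slope_family p a)).
Proof.
move=> sp; apply: (@pointwise_inf_sublinear _ (fun x => - p (- x))).
- by exists (fun x => p (x + 0 *: a) - 0 * p a); exists 0 => //=.
- by move=> q x; exact: slope_family_lb.
- move=> _ _ [t t0 <-] [s s0 <-].
  exists (fun x => p (x + (t + s) *: a) - (t + s) * p a).
    by exists (t + s) => //=; exact: addr_ge0.
  move=> x y; have := sp.1 (x + t *: a) (y + s *: a).
  by rewrite addrACA -scalerDl; lra.
- move=> _ t [s s0 <-] t0.
  exists (fun x => p (x + (t * s) *: a) - (t * s) * p a).
    by exists (t * s) => //=; exact: mulr_ge0.
  move=> x; have := sp.2 t (x + s *: a) t0.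
  by rewrite scalerDr scalerA; lra.
Qed.

Lemma slope_le p a x (t : R) : sublinear p -> 0 <= t ->
  pointwise_inf (slope_family p a) x <= p (x + t *: a) - t * p a.
Proof.
move=> sp t0.
apply: (@pointwise_inf_lb _ (fun x => - p (- x))
  (fun x => p (x + t *: a) - t * p a)).
  by move=> q y; exact: slope_family_lb.
by exists t.
Qed.

(** Lower bounds of chains, for Zorn's lemma. The bound by a single [p0] keeps
    the pointwise infimum finite: a sublinear [p] below [p0] satisfies
    [p x >= - p (- x) >= - p0 (- x)]. *)
Lemma sublinear_chain_lb (C : set {p | sublinear p}) (p0 : V -> R) :
  sublinear p0 -> C !=set0 ->
  (forall c x, C c -> sval c x <= p0 x) ->
  (forall c d, C c -> C d ->
    (forall x, sval c x <= sval d x) \/ (forall x, sval d x <= sval c x)) ->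
  exists2 q, sublinear q & forall c x, C c -> q x <= sval c x.
Proof.
move=> sp0 [c0 Cc0] hle hC; pose P := [set sval c | c in C].
have hlb p x : P p -> - p0 (- x) <= p x.
  move=> [c Cc <-]; have := hle c (- x) Cc.
  by have := sublinearN _ x (svalP c); lra.
exists (pointwise_inf P); last first.
  by move=> c x Cc; apply: pointwise_inf_lb hlb _; exists c.
apply: pointwise_inf_sublinear hlb _ _; first by exists (sval c0), c0.
- move=> _ _ [c Cc <-] [d Cd <-]; case: (hC _ _ Cc Cd) => h.
    exists (sval c); first by exists c.
    by move=> x y; have := (svalP c).1 x y; have := h y; lra.
  exists (sval d); first by exists d.
  by move=> x y; have := (svalP d).1 x y; have := h x; lra.
- move=> _ t [c Cc <-] t0; exists (sval c); first by exists c.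
  by move=> x; exact: (svalP c).2.
Qed.

Lemma exists_minimal_sublinear p : sublinear p ->
  exists2 q, sublinear q /\ (forall x, q x <= p x) &
    forall r, sublinear r -> (forall x, r x <= q x) -> forall x, q x <= r x.
Proof.
move=> sp.
pose T := {q : V -> R | sublinear q /\ forall x, q x <= p x}.
pose r (c d : T) := `[< forall x, sval d x <= sval c x >].
have t0 : T by exists p.
have [||C totC|[q [sq qp]] qmin] := @ZL_preorder T t0 r.
- by move=> t; apply/asboolP.
- move=> c d e /asboolP h1 /asboolP h2; apply/asboolP => x.
  exact: le_trans (h2 x) (h1 x).
- have [C0|/set0P[c0 Cc0]] := eqVneq C set0; first by exists t0 => s; rewrite C0.
  pose sub (c : T) : {p | sublinear p} := exist _ (sval c) (svalP c).1.
  have [|||q sq hq] := @sublinear_chain_lb [set sub c | c in C] p sp.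
  + by exists (sub c0), c0.
  + by move=> _ x [c Cc <-]; exact: (svalP c).2.
  + move=> _ _ [c Cc <-] [d Cd <-].
    by case: (totC _ _ Cc Cd) => /asboolP; [right|left].
  + have qC c x : C c -> q x <= sval c x.
      by move=> Cc; apply: (hq (sub c)); exists c.
    have qp x : q x <= p x := le_trans (qC c0 x Cc0) ((svalP c0).2 x).
    by exists (exist _ q (conj sq qp)) => s Cs; apply/asboolP => x; exact: qC.
- exists q => // s ss sq'.
  have sp' x : s x <= p x := le_trans (sq' x) (qp x).
  by apply/asboolP/(qmin (exist _ s (conj ss sp'))); apply/asboolP.
Qed.

(** By minimality [q] is below its own infimum of slopes in the direction [y];
    the term of parameter 1 reads [q x <= q (x + y) - q y]. *)
Lemma minimal_sublinear_additive q : sublinear q ->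
  (forall r, sublinear r -> (forall x, r x <= q x) -> forall x, q x <= r x) ->
  forall x y, q (x + y) = q x + q y.
Proof.
move=> sq qmin x y; apply/eqP; rewrite eq_le sq.1/=.
have sl z : pointwise_inf (slope_family q y) z <= q z.
  by have := slope_le q y z 0 sq (lexx 0); rewrite scale0r addr0 mul0r subr0.
have := qmin _ (slope_sublinear q y sq) sl x.
by have := slope_le q y x 1 sq ler01; rewrite scale1r mul1r; lra.
Qed.

(** The Hahn-Banach theorem, without a prescribed subspace. *)
Lemma sublinear_dominates_linear p : sublinear p ->
  exists f : {scalar V}, forall x, f x <= p x.
Proof.
move=> /exists_minimal_sublinear[q [sq qp] qmin].
have qD := minimal_sublinear_additive _ sq qmin.
have qN x : q (- x) = - q x.
  by have := qD (- x) x; rewrite addNr (sublinear0 _ sq); lra.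
have qZ0 (t : R) x : 0 <= t -> q (t *: x) = t * q x.
  by move=> t0; apply/eqP; rewrite eq_le sq.2// sublinear_ge.
have qZ (t : R) x : q (t *: x) = t * q x.
  have [t0|t0] := leP 0 t; first exact: qZ0.
  by rewrite -[t]opprK scaleNr qN qZ0 ?mulNr// oppr_ge0 ltW.
have qlin : scalar q by move=> t x y; rewrite qD qZ.
pose f : {scalar V} := HB.pack q (GRing.isLinear.Build _ _ _ _ q qlin).
by exists f.
Qed.

End sublinear.

(** Dominating the slopes of the norm in the direction [c], rather than the norm
    itself, forces [f (- c) <= - `|c|]. *)
Lemma norming_functional (R : realType) (X : normedModType R) (c : X) :
  exists f : {scalar X}, (forall x, `|f x| <= `|x|) /\ f c = `|c|.
Proof.
have sn : sublinear (fun x : X => `|x|).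
  by split=> [x y|t x t0]; [exact: ler_normD | rewrite normrZ ger0_norm].
have [f fle] := sublinear_dominates_linear _ (slope_sublinear _ c sn).
have fn x : f x <= `|x|.
  apply: le_trans (fle x) _.
  by have := slope_le _ c x 0 sn (lexx 0); rewrite scale0r addr0 mul0r subr0.
exists f; split.
  by move=> x; rewrite ler_norml fn andbT lerNl -raddfN/= -(normrN x) fn.
apply/eqP; rewrite eq_le fn/=.
have := le_trans (fle (- c)) (slope_le _ c (- c) 1 sn ler01).
by rewrite scale1r addNr normr0 mul1r sub0r raddfN/= lerN2.
Qed.

(** * Finitely many functionals on a compact set *)

(** The functionals norm the differences of the points of an [e / 4]-net of
    [A]. Replacing [a] and [b] by points of the net costs [e / 4] each, once in
    the norm and once in the functional. *)
Lemma compact_finite_norming (R : realType) (X : normedModType R) (A : set X)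
    (e : R) : compact A -> 0 < e ->
  exists (I : finType) (phi : I -> {scalar X}),
    (forall i x, `|phi i x| <= `|x|) /\
    forall a b, A a -> A b -> exists i, `|a - b| <= phi i (a - b) + e.
Proof.
rewrite compact_cover => cA e0.
have e40 : 0 < e / 4 by rewrite divr_gt0.
have [D _ AD] : finite_subset_cover setT (fun c : X => ball c (e / 4)) A.
  apply: cA => [c _|a Aa]; first exact: ball_open.
  by exists a => //; exact: ballxx.
have {AD} net a : A a -> exists c : D, `|val c - a| < e / 4.
  by move=> /AD[c /= cD]; rewrite -ball_normE /= => h; exists [` cD]%fset.
have /choice[phi phiP] := @norming_functional R X.
exists (D * D)%type, (fun cd => phi (val cd.1 - val cd.2)).
split=> [cd x|a b /net[c ca] /net[d db]]; first exact: (phiP _).1.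
exists (c, d) => /=; have [phi_le phi_eq] := phiP (val c - val d).
have phi_lt x : `|x| < e / 4 -> `|phi (val c - val d) x| < e / 4.
  exact: le_lt_trans (phi_le x).
have := phi_lt _ ca; have := phi_lt _ db; rewrite !ltr_norml.
have -> : a - b = (val c - val d) - (val c - a) + (val d - b).
  by rewrite opprB [_ + (a - val c)]addrC !subrKA.
set f := phi _ in phi_eq *.
have := ler_normD (val c - val d - (val c - a)) (val d - b).
have := ler_normB (val c - val d) (val c - a).
rewrite [f (_ + (val d - b))]raddfD /= [f (_ - (val c - a))]raddfB /= phi_eq.
by lra.
Qed.

(** * Riemann sums *)

Section riemann_sums.
Context {R : realType} {X : normedModType R}.
Implicit Types (F : R -> set X) (A : set X) (T : tagged_partition R).

Lemma big_minkowski_sumP (n : nat) (G : 'I_n -> set X) (x : X) :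
  (\big[minkowski_sum/[set 0]]_(i < n) G i) x <->
  exists2 y : 'I_n -> X, (forall i, G i (y i)) & x = \sum_(i < n) y i.
Proof.
elim: n G x => [|n IH] G x.
  rewrite big_ord0; split => [->|[y _ ->]]; last by rewrite big_ord0.
  by exists (fun=> 0); [case | rewrite big_ord0].
rewrite big_ord_recl; split=> [[a Ga [b /IH[y Gy ->] <-]]|[y Gy ->]].
  exists (fun i => if unlift ord0 i is Some j then y j else a) => [i|].
    by case: unliftP => [j ->|->].
  rewrite big_ord_recl unlift_none; congr (_ + _).
  by apply: eq_bigr => j _; rewrite liftK.
rewrite big_ord_recl; exists (y ord0) => //.
by exists (\sum_(i < n) y (lift ord0 i)) => //; apply/IH;
  exists (y \o lift ord0).
Qed.

Lemma riemann_sumP F T x : riemann_sum F T x <->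
  exists2 y : 'I_(size (tp_points T)) -> X, (forall i, F (tp_tag i) (y i)) &
    x = \sum_(i < size (tp_points T)) tp_length T i *: y i.
Proof.
split=> [/big_minkowski_sumP[z Gz ->]|[y Fy ->]]; last first.
  by apply/big_minkowski_sumP; exists (fun i : 'I__ => tp_length T i *: y i) => // i;
    exists (y i).
have /choice[y yP] i : exists y, F (tp_tag i) y /\ tp_length T i *: y = z i.
  by have [y Fy <-] := Gz i; exists y.
by exists y => [i|]; [exact: (yP i).1|];
  apply: eq_bigr => i _; rewrite (yP i).2.
Qed.

Lemma riemann_sumS (F G : R -> set X) T : (forall t, F t `<=` G t) ->
  riemann_sum F T `<=` riemann_sum G T.
Proof.
move=> FG x /riemann_sumP[y Fy ->]; apply/riemann_sumP.
by exists y => // i; exact/FG.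
Qed.

Lemma tp_length_gt0 T (i : 'I_(size (tp_points T))) : 0 < tp_length T i.
Proof.
have [/(pathP 1) + _] := tp_partition T; move=> /(_ i (ltn_ord i)).
by rewrite /tp_length subr_gt0.
Qed.

Lemma sum_tp_length T : \sum_(i < size (tp_points T)) tp_length T i = 1.
Proof.
rewrite -(big_mkord xpredT (tp_length T)) telescope_sumr//=.
by rewrite (itv_partition_nth_size _ (tp_partition T)) subr0.
Qed.

Lemma tp_length_le_mesh T (i : 'I_(size (tp_points T))) :
  tp_length T i <= mesh T.
Proof. by rewrite /mesh (le_bigmax _ (fun i : 'I__ => tp_length T i)). Qed.

Lemma tp_tag01 T (i : 'I_(size (tp_points T))) : 0 <= tp_tag i <= 1.
Proof.
have /andP[h1 h2] := tp_tagP i.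
rewrite (le_trans _ h1)/=; last first.
  by rewrite (itv_partition_nth_ge _ (tp_partition T))// ltnS ltnW.
by rewrite (le_trans h2)// (itv_partition_nth_le _ (tp_partition T))// ltnS.
Qed.

Lemma sum_sqr_tp_length_le T :
  \sum_(i < size (tp_points T)) tp_length T i ^+ 2 <= mesh T.
Proof.
rewrite -[leRHS]mulr1 -[in leRHS](sum_tp_length T) mulr_sumr.
apply: ler_sum => i _; rewrite expr2 ler_pM2r ?tp_length_gt0//.
exact: tp_length_le_mesh.
Qed.

Lemma nat_bracket (g : nat -> R) (n : nat) (t : R) : (0 < n)%N ->
  g 0 <= t <= g n -> exists2 i, (i < n)%N & g i <= t <= g i.+1.
Proof.
elim: n => // n IH _ /andP[g0 gn]; have [tn|tn] := leP (g n) t.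
  by exists n => //; rewrite tn.
case: n IH tn gn => [|n] IH tn gn; first
  by move: (le_lt_trans g0 tn); rewrite ltxx.
have [|i lt_in h] := IH isT; first by rewrite g0 ltW.
by exists i => //; exact: ltnW.
Qed.

Lemma tp_size_gt0 T : (0 < size (tp_points T))%N.
Proof.
rewrite lt0n; apply/eqP => s0; have := itv_partition_nth_size 1 (tp_partition T).
by rewrite s0 /= => /eqP; rewrite eq_sym oner_eq0.
Qed.

(** Any [t] can be made the tag of the interval containing it, the other tags
    being kept; the effect on a Riemann sum is to exchange one term. *)
Lemma retag T (t : R) : 0 <= t <= 1 ->
  exists i : 'I_(size (tp_points T)), exists2 T', mesh T' = mesh T &
    forall F (y : 'I_(size (tp_points T)) -> X) (v : X),
      (forall j, F (tp_tag j) (y j)) -> F t v ->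
      riemann_sum F T'
        (\sum_(j < size (tp_points T)) tp_length T j *: y j +
          tp_length T i *: (v - y i)).
Proof.
move=> t01; pose g := nth 1 (0 :: tp_points T).
have [|i lt_i hi] := nat_bracket g _ t (tp_size_gt0 T).
  by rewrite /g /= (itv_partition_nth_size _ (tp_partition T)).
pose j0 := Ordinal lt_i.
pose tag j := if j == j0 then t else tp_tag (t := T) j.
have tagP (j : 'I_(size (tp_points T))) : g j <= tag j <= g j.+1.
  by rewrite /tag; case: eqP => [->|_] //; exact: tp_tagP.
exists j0, (@TaggedPartition R _ tag (tp_partition T) tagP) => // F y v Fy Fv.
apply/riemann_sumP; exists (fun j => if j == j0 then v else y j) => /= [j|].
  by rewrite /tag; case: eqP.
rewrite [in RHS](bigD1 j0)//= eqxx (bigD1 j0)//= addrAC -scalerDr addrC.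
rewrite addrC subrKC; congr (_ + _).
by apply: eq_bigr => j /negbTE ->.
Qed.

(** For a fixed fine partition, the Riemann sums before and after an exchange of
    one tag lie in the same ball of radius [B + 1], so a point [v] of [F t] and
    the point [y i] that it replaces satisfy
    [tp_length T i * `|v - y i| <= 2 * (B + 1)]. The sum over all [i] serves as
    a bound that does not depend on the interval containing [t]. *)
Lemma riemann_integrable_bounded F :
  (forall t, 0 <= t <= 1 -> F t !=set0) -> riemann_integrable F ->
  exists M : R, forall t v, 0 <= t <= 1 -> F t v -> `|v| <= M.
Proof.
move=> F0 [A [[[_ bA] _] /(_ 1 ltr01)[d d0 hd]]].
have {bA}[B _ AB] := pinfty_ex_gt0 bA.
have SB T x : mesh T < d -> riemann_sum F T x -> `|x| <= B + 1.
  move=> /hd/hausdorff_dist_lt[_ SA] /SA[a /AB /= aB xa].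
  by have := ler_normD a (x - a); rewrite addrC subrK; lra.
have [T Td] := exists_fine_tagged_partition d0.
have /choice[y Fy] (i : 'I_(size (tp_points T))) : exists v, F (tp_tag i) v.
  exact/F0/tp_tag01.
pose b (i : 'I_(size (tp_points T))) :=
  `|y i| + 2 * (B + 1) / tp_length T i.
have B0 : 0 <= B + 1.
  apply: le_trans (SB T (\sum_(i < size (tp_points T)) tp_length T i *: y i) Td _);
    first exact: normr_ge0.
  by apply/riemann_sumP; exists y.
have b0 i : 0 <= b i.
  by rewrite addr_ge0// divr_ge0 ?mulr_ge0// ltW// tp_length_gt0.
exists (\sum_i b i) => t v /(retag T)[i [T' TT' /(_ F y v Fy) + Fv]].
move=> /(_ Fv)/SB; rewrite TT' => /(_ Td) h.
have hy : `|\sum_(j < size (tp_points T)) tp_length T j *: y j| <= B + 1.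
  by apply: (SB T) => //; apply/riemann_sumP; exists y.
have l0 := tp_length_gt0 T i.
rewrite (bigD1 i)//=; apply: ler_wpDr; first exact: sumr_ge0.
rewrite /b -[v in leLHS](subrK (y i)) addrC.
apply: le_trans (ler_normD _ _) _; rewrite lerD2l ler_pdivlMr//.
rewrite mulrC -[tp_length T i in leLHS]gtr0_norm// -normrZ.
set S := \sum_(j < _) _ in h hy.
have := ler_normB (S + tp_length T i *: (v - y i)) S; rewrite addrAC subrr add0r.
by lra.
Qed.

Lemma hausdorff_dist_le A B (e : R) :
  (forall b, B b -> exists2 a, A a & `|b - a| <= e) ->
  (forall a, A a -> exists2 b, B b & `|a - b| <= e) ->
  (hausdorff_dist A B <= e%:E)%E.
Proof.
move=> hB hA; rewrite ge_max; apply/andP; split; apply: ge_ereal_sup.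
  move=> _ [b /hB[a Aa ba] <-]; apply: ge_ereal_inf; exists `|b - a|%:E => //.
  by exists a.
move=> _ [a /hA[b Bb ab] <-]; apply: ge_ereal_inf; exists `|a - b|%:E => //.
by exists b.
Qed.

(** * Selecting points from the sets instead of their convex hulls *)

Lemma convex_set_comb (C : set X) :
  (forall u v (t : R), C u -> C v -> 0 < t -> t < 1 ->
    C (t *: u + (1 - t) *: v)) -> convex_set (C : set (convex_lmodType X)).
Proof.
move=> h; apply/convex_setW => u v /set_mem Cu /set_mem Cv k k0 k1.
by apply/mem_set; exact: h.
Qed.

(** Otherwise [G] lies in the open half-space [f > f y], which is convex and
    hence contains [y]. *)
Lemma convex_hull_scalar_le (G : set X) (f : {scalar X}) (y : X) :
  convex_hull G y -> exists2 v, G v & f v <= f y.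
Proof.
move=> Gy; apply: contrapT => nG.
suff: [set v | f y < f v] y by rewrite /= ltxx.
apply: Gy; split=> [|v Gv] /=; last first.
  by rewrite ltNge; apply/negP => le_v; apply: nG; exists v.
by apply: convex_set_comb => u v t /= fu fv t0 t1; rewrite linearD !linearZ /=; nra.
Qed.

(** The quadratic form [\sum_i phi i x ^+ 2] replaces the square of the norm in
    the argument that works in a Hilbert space: [z k] is chosen so that
    [z k - y k] does not point in the direction of the error made so far, so the
    squares of the increments add up. The bound does not see the number [n] of
    terms other than through [\sum_k l k ^+ 2]. *)
Lemma balanced_selection (I : finType) (phi : I -> {scalar X}) (K : R) (n : nat)
    (l : 'I_n -> R) (G : 'I_n -> set X) (y : 'I_n -> X) :
  (forall i x, `|phi i x| <= `|x|) ->
  (forall k, 0 <= l k) ->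
  (forall k, convex_hull (G k) (y k)) ->
  (forall k v, G k v -> `|v - y k| <= K) ->
  exists2 z : 'I_n -> X, (forall k, G k (z k)) &
    \sum_i phi i (\sum_(k < n) l k *: (z k - y k)) ^+ 2
      <= #|I|%:R * K ^+ 2 * \sum_(k < n) l k ^+ 2.
Proof.
move=> phi1; elim: n l G y => [|n IH] l G y l0 Gy GK.
  exists (fun=> 0); first by case.
  by rewrite !big_ord0 mulr0 big1// => i _; rewrite raddf0 expr0n.
have [z Gz hz] := IH (l \o lift ord0) (G \o lift ord0) (y \o lift ord0)
  (fun k => l0 _) (fun k => Gy _) (fun k => GK _).
set e := \sum_(k < n) _ in hz.
(* Half of the differential, at the error [e] already made, of the quadratic
   form. *)
pose grad x := \sum_i phi i e * phi i x.
have grad_lin : scalar grad.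
  move=> t u v; rewrite /grad mulr_sumr -big_split/=; apply: eq_bigr => i _.
  by rewrite linearP/=; ring.
pose f : {scalar X} := HB.pack grad (GRing.isLinear.Build _ _ _ _ grad grad_lin).
have [v Gv fv] := convex_hull_scalar_le _ f _ (Gy ord0).
exists (fun k => if unlift ord0 k is Some j then z j else v) => [k|].
  by case: unliftP => [j ->|->] //; exact: Gz.
set w := v - y ord0; set lam := l ord0.
have grad_w : grad w <= 0.
  rewrite (_ : grad w = f v - f (y ord0)) ?subr_le0//.
  by rewrite -raddfB.
have sum_w : \sum_i phi i w ^+ 2 <= #|I|%:R * K ^+ 2.
  rewrite mulr_natl -sumr_const; apply: ler_sum => i _.
  rewrite -ler_sqrt ?sqr_ge0// !sqrtr_sqr; apply: le_trans (phi1 i w) _.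
  exact: le_trans (GK ord0 v Gv) (ler_norm K).
have -> : \sum_(k < n.+1) l k *:
    ((if unlift ord0 k is Some j then z j else v) - y k) = lam *: w + e.
  rewrite big_ord_recl unlift_none; congr (_ + _).
  by apply: eq_bigr => j _; rewrite liftK.
have -> : \sum_i phi i (lam *: w + e) ^+ 2 =
    \sum_i phi i e ^+ 2 + 2 * lam * grad w + lam ^+ 2 * \sum_i phi i w ^+ 2.
  rewrite /grad !mulr_sumr -!big_split/=; apply: eq_bigr => i _.
  by rewrite linearP/=; ring.
rewrite big_ord_recl mulrDr [leRHS]addrC -addrA.
apply: lerD hz _; rewrite -[leRHS]add0r; apply: lerD.
  by rewrite mulr_ge0_le0// mulr_ge0// l0.
by rewrite [leRHS]mulrC ler_wpM2l// sqr_ge0.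
Qed.
End riemann_sums.

Lemma sqr_sum_bound (R : realType) (I : finType) (g : I -> R) (e : R) :
  0 <= e -> \sum_i g i ^+ 2 <= e ^+ 2 -> forall i, `|g i| <= e.
Proof.
move=> e0 h i; rewrite -(ler_pXn2r (ltn0Sn 1)) ?nnegrE// real_normK ?num_real//.
by apply: le_trans h; rewrite (bigD1 i)//= lerDl sumr_ge0// => j _; exact: sqr_ge0.
Qed.

(** * The theorem *)

Lemma riemann_integral_of_convex_hull (R : realType) (X : normedModType R)
    (F : R -> set X) (A : set X) :
  (forall t, 0 <= t <= 1 -> F t !=set0) -> compact A ->
  is_riemann_integral (fun t => convex_hull (F t)) A -> is_riemann_integral F A.
Proof.
move=> F0 cA hA; have [clbA hconv] := hA; split=> // eps eps0.
have Fconv t : F t `<=` convex_hull (F t) by exact: sub_gen_smallest.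
(* The points approximating [A] end up within [5 * e]: three terms of size [e]
   under a functional, the precision [e] of that functional, and the distance
   of the selected sum to [A]. *)
pose e := eps / 16; have e0 : 0 < e by rewrite divr_gt0.
have [M FM] : exists M : R,
    forall t v, 0 <= t <= 1 -> convex_hull (F t) v -> `|v| <= M.
  apply: riemann_integrable_bounded; last by exists A.
  by move=> t /F0[v Fv]; exists v; exact: Fconv.
have [I [phi [phi1 phiA]]] := compact_finite_norming _ _ A e cA e0.
have [d1 d10 hd1] := hconv _ e0.
pose C := #|I|%:R * (2 * M) ^+ 2.
have C0 : 0 <= C by rewrite mulr_ge0// sqr_ge0.
(* The second bound makes the quadratic form at most [e ^+ 2] at the error;
   [C + 1] rather than [C] because [C] may vanish. *)
exists (Order.min d1 (e ^+ 2 / (C + 1))).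
  by rewrite lt_min d10 divr_gt0 ?exprn_gt0// ltr_wpDl.
move=> T; rewrite lt_min => /andP[/hd1/hausdorff_dist_lt[A_near S_near] Td2].
have sub_conv : riemann_sum F T `<=` riemann_sum (fun t => convex_hull (F t)) T.
  exact: riemann_sumS.
apply: (@le_lt_trans _ _ (eps / 2)%:E); last by rewrite lte_fin; lra.
apply: hausdorff_dist_le => [a Aa|x /sub_conv/S_near[b Ab xb]]; last first.
  by exists b => //; apply: ltW; apply: lt_trans xb _; rewrite /e; lra.
have [_ /riemann_sumP[y Gy ->] ay] := A_near _ Aa.
have K_bound k v : F (tp_tag k) v -> `|v - y k| <= 2 * M.
  move=> Fv; have t01 := tp_tag01 T k.
  have := FM _ _ t01 (Fconv _ _ Fv); have := FM _ _ t01 (Gy k).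
  by have := ler_normB v (y k); lra.
have [z Fz hz] := balanced_selection I phi (2 * M) _
  (fun k : 'I_(size (tp_points T)) => tp_length T k)
  (fun k => F (tp_tag k)) y phi1 (fun k => ltW (tp_length_gt0 T k)) Gy K_bound.
set err := \sum_(k < _) _ in hz.
have {hz} phi_err : forall i, `|phi i err| <= e.
  apply: sqr_sum_bound; first exact: ltW.
  apply: le_trans hz _; rewrite -/C.
  apply: le_trans (ler_wpM2l C0 (sum_sqr_tp_length_le T)) _.
  move: Td2; rewrite ltr_pdivlMr; last by rewrite ltr_wpDl.
  have : 0 <= mesh T :=
    le_trans (sumr_ge0 _ (fun i _ => sqr_ge0 _)) (sum_sqr_tp_length_le T).
  by nra.
set s := \sum_(k < size (tp_points T)) tp_length T k *: z k.
have sS : riemann_sum F T s by apply/riemann_sumP; exists z.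
exists s => //; set x := \sum_(k < _) _ in ay.
have errE : err = s - x.
  by rewrite /err /s /x -sumrB; apply: eq_bigr => k _; rewrite scalerBr.
have [b Ab sb] := S_near _ (sub_conv _ sS).
have [i] := phiA _ _ Aa Ab.
have -> : a - b = (a - x) - err + (s - b) by rewrite errE opprB !subrKA.
rewrite raddfD /= [phi i (_ - err)]raddfB /=.
have := phi_err i; have := phi1 i (a - x); have := phi1 i (s - b).
rewrite !ler_norml => /andP[_ h1] /andP[_ h2] /andP[h3 _] h4.
have -> : a - s = (a - x - err + (s - b)) - (s - b).
  by rewrite errE opprB !subrKA opprB subrKA.
apply: le_trans (ler_normB _ _) _.
by rewrite /e in sb ay h1 h2 h3 h4 *; lra.
Qed.

Theorem theorem4p3 (R : realType) (X : completeNormedModType R)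
    (F : R -> set X) (hF : forall t : R, 0 <= t <= 1 -> in_b (F t))
    (hI : riemann_integrable (fun t => convex_hull (F t)))
    (hA : compact (riemann_integral (fun t => convex_hull (F t)))) :
  riemann_integrable F /\
  riemann_integral F = riemann_integral (fun t => convex_hull (F t)).
Proof.
apply/riemann_integralP/riemann_integral_of_convex_hull => //.
  by move=> t /hF[].
by apply/riemann_integralP.
Qed.
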